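(* Let $\Gamma$ be an immersed, connected, $C^2$ planar curve with total curvature $\int_\Gamma|\kappa|\,ds\le\alpha\pi$ for some positive integer $\alpha$. Then $\mathrm{Ent}[\Gamma]\le 4\alpha\sqrt{2}$.
   Context: $\kappa$ is the signed curvature and $ds$ arc length. For a curve $\Gamma$, $F_{x_0,\lambda}[\Gamma]=\frac{1}{\sqrt{4\pi\lambda}}\int_\Gamma e^{-|x-x_0|^2/(4\lambda)}\,ds$ (integral over the parametrization) and $\mathrm{Ent}[\Gamma]=\sup_{x_0\in\mathbb{R}^2,\lambda>0}F_{x_0,\lambda}[\Gamma]$. *)

(* Defs.v *)
From HB Require Import structures.
From mathcomp Require Import all_boot all_order all_algebra.
From mathcomp Require Import all_classical all_reals all_analysis.
Set Implicit Arguments. Unset Strict Implicit. Unset Printing Implicit Defensive.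
Import Order.TTheory GRing.Theory Num.Theory.
Import numFieldNormedType.Exports.
Local Open Scope classical_set_scope.
Local Open Scope ring_scope.

Section CurveDefs.
Variable R : realType.

Definition param_int (a b : \bar R) : set R := [set t | (a < t%:E < b)%E].

Definition C2_on (f : R -> R) (D : set R) : Prop :=
  forall t, D t ->
    [/\ derivable f t 1, derivable (derive1 f) t 1 & {for t, continuous (derive1 (derive1 f))}].

Definition immersed_on (x y : R -> R) (D : set R) : Prop :=
  forall t, D t -> (derive1 x t, derive1 y t) != (0, 0).

(* speed |gamma'(t)|, so that ds = speed dt *)
Definition speed (x y : R -> R) (t : R) : R :=
  Num.sqrt (derive1 x t ^+ 2 + derive1 y t ^+ 2).

Definition curvature (x y : R -> R) (t : R) : R :=
  (derive1 x t * derive1 (derive1 y) t - derive1 y t * derive1 (derive1 x) t) / speed x y t ^+ 3.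

Definition total_curvature (x y : R -> R) (a b : \bar R) : \bar R :=
  (\int[lebesgue_measure]_(t in param_int a b)
     (`|curvature x y t| * speed x y t)%:E)%E.

Definition Fgauss (x y : R -> R) (a b : \bar R) (x0 : R * R) (lam : R) : \bar R :=
  ((Num.sqrt (4 * pi * lam))^-1)%:E *
  (\int[lebesgue_measure]_(t in param_int a b)
     (expR (- ((x t - x0.1) ^+ 2 + (y t - x0.2) ^+ 2) / (4 * lam))
        * speed x y t)%:E)%E.

Definition Ent (x y : R -> R) (a b : \bar R) : \bar R :=
  ereal_sup [set e | exists (x0 : R * R) (lam : R), 0 < lam /\ e = Fgauss x y a b x0 lam].

End CurveDefs.

(* Main.v *)
Require Import Defs.
From HB Require Import structures.
From mathcomp Require Import all_boot all_order all_algebra.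
From mathcomp Require Import all_classical all_reals all_analysis.
From mathcomp Require Import measurable_realfun ring lra.
Import Order.TTheory GRing.Theory Num.Theory.
Import numFieldNormedType.Exports.
Local Open Scope classical_set_scope.
Local Open Scope ring_scope.

(** A curve of total curvature at most [alpha * pi] is cut into [2 * alpha] arcs of
    total curvature at most [pi / 2].  The unit tangent [T] moves by at most the
    curvature traversed, so on each arc it stays within [pi / 4 < 1] of its value
    [e] at the curvature midpoint and [T . e >= 1 / 2].  The arc is then a graph over
    the line spanned by [e], with [ds <= 2 du] for [u] the coordinate along [e]; as
    projecting onto that line decreases distances, the arc contributes at most [2],
    twice the mass of a one-dimensional Gaussian.  This gives [4 * alpha] on compact
    subintervals of the parameter interval, and monotone convergence concludes. *)

(** * Primitives of continuous densities, and integrals over exhausting intervals *)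

Section primitives.
Context {R : realType}.
Notation mu := (@lebesgue_measure R).

Lemma le_of_derive_ge0 (f df : R -> R) (s t : R) : s <= t ->
  {in `[s, t], forall r : R, is_derive r 1 f (df r)} ->
  {in `[s, t], forall r, 0 <= df r} -> f s <= f t.
Proof.
move=> st fdf df0.
have fdfo : forall r, r \in `]s, t[%R -> is_derive r 1 f (df r).
  by move=> r /subset_itv_oo_cc; exact: fdf.
have cf : {within `[s, t], continuous f}.
  by apply: derivable_within_continuous => r /fdf ?; exact: ex_derive.
have [c cst fE] := MVT_segment st fdfo cf.
by rewrite -subr_ge0 fE mulr_ge0 ?subr_ge0// df0.
Qed.

(** The primitive is the integral from [A]. The derivative is two-sided, hence claimed only on the
    open interval; uses on a closed interval first enlarge it. *)
Lemma primitive_exists (f : R -> R) (A B : R) :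
  {in `[A, B], continuous f} ->
  exists F : R -> R, {in `]A, B[, forall t : R, is_derive t 1 F (f t)}.
Proof.
move=> cf; have cwf : {within `[A, B], continuous f}.
  by apply: continuous_in_subspaceT => t; rewrite inE; exact: cf.
have intf : mu.-integrable `[A, B] (EFin \o f).
  by apply: continuous_compact_integrable => //; exact: segment_compact.
exists (fun u => (\int[mu]_(t in `[A, u]) f t)%R) => t tAB.
have /andP[At tB] : A < t < B by move: tAB; rewrite in_itv.
have [dF F'] := @continuous_FTC1_closed _ _ _ t B tB intf At
  (cf t (subset_itv_oo_cc tAB)).
by apply: DeriveDef => //; rewrite -derive1E.
Qed.

Lemma integral_primitive (f F : R -> R) (p q : R) : p <= q ->
  {in `[p, q], continuous f} ->
  {in `[p, q], forall t : R, is_derive t 1 F (f t)} ->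
  (\int[mu]_(t in `[p, q]) (f t)%:E = (F q - F p)%:E)%E.
Proof.
rewrite le_eqVlt => /predU1P[<- _ _|pq cf dF].
  by rewrite set_itv1 integral_set1 subrr.
rewrite (@continuous_FTC2 _ f F)//.
- by apply: continuous_in_subspaceT => t; rewrite inE; exact: cf.
- have cF : {in `[p, q], continuous F}.
    move=> t /dF dFt; apply/differentiable_continuous/derivable1_diffP.
    exact: ex_derive.
  split.
  + by move=> t /subset_itv_oo_cc/dF ?; exact: ex_derive.
  + by apply: cvg_at_right_filter; apply: cF; rewrite in_itv/= lexx ltW.
  + by apply: cvg_at_left_filter; apply: cF; rewrite in_itv/= lexx ltW.
- by move=> t /subset_itv_oo_cc/dF ?; rewrite derive1E derive_val.
Qed.

(** One-dimensional Gaussian mass enters the argument as an increment of [Phi], bounded by the total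
    mass 1 of the density. *)
Lemma normal_primitive (m s : R) (u w : R) : s != 0 ->
  exists2 Phi : R -> R, {in `[u, w], forall t : R, is_derive t 1 Phi (normal_pdf m s t)}
    & u <= w -> Phi w - Phi u <= 1.
Proof.
move=> s0; have cn := @continuous_normal_pdf R m s s0.
(* A margin of 1 on both sides puts [u] and [w] inside the open interval of differentiability. *)
have [Phi dPhi] := @primitive_exists (normal_pdf m s) (u - 1) (w + 1)
  (fun t _ => cn t).
have dPhi' : {in `[u, w], forall t : R, is_derive t 1 Phi (normal_pdf m s t)}.
  move=> t; rewrite in_itv/= => /andP[ut tw]; apply: dPhi.
  by rewrite in_itv/=; apply/andP; split; lra.
exists Phi => // uw.
rewrite -lee_fin -(@integral_primitive (normal_pdf m s))//.
  rewrite -(@integral_normal_pdf R m s); apply: ge0_subset_integral => //=.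
  - by apply/measurable_EFinP; exact: measurable_normal_pdf.
  - by move=> t _; rewrite lee_fin normal_pdf_ge0.
Qed.

(** Monotone convergence along the increasing intervals with union [D]; the first few of them may be
    empty. *)
Lemma integral_exhaust_le (D : set R) (p q : R^nat) (f : R -> R) (M : \bar R) :
  open D -> {in D, continuous f} -> {in D, forall t, 0 <= f t} ->
  (forall n, `[p n, q n] `<=` D) ->
  nonincreasing_seq p -> nondecreasing_seq q ->
  (forall t, D t -> exists n, p n <= t <= q n) ->
  (forall n, (\int[mu]_(t in `[p n, q n]) (f t)%:E <= M)%E) ->
  (\int[mu]_(t in D) (f t)%:E <= M)%E.
Proof.
move=> oD cf f0 sub pd qi exh bnd.
have DE : D = \bigcup_n [set` `[p n, q n]].
  apply/seteqP; split => [t /exh[n pq]|t [n _]]; last exact: sub.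
  by exists n => //=; rewrite in_itv.
have mf : measurable_fun D f by exact: open_continuous_measurable_fun.
rewrite DE; apply: (cvge_to_le (ge0_nondecreasing_set_cvg_integral _ _ _ _)).
- apply/nondecreasing_seqP => n; apply/subsetPset; apply: subset_itvScc.
    by rewrite bnd_simp; apply: pd.
  by rewrite bnd_simp; apply: qi.
- by move=> n; exact: measurable_itv.
- move=> n; apply/measurable_EFinP; apply: measurable_funS mf => //.
  exact: open_measurable.
- by move=> n t /sub Dt; rewrite lee_fin f0// inE.
- exact: nearW.
Qed.

End primitives.

(** * The unit tangent and its rotation along the curve *)

Section tangent.
Context {R : realType}.
Variables (x y : R -> R) (D : set R).
Hypotheses (C2x : C2_on x D) (C2y : C2_on y D) (imm : immersed_on x y D).

Notation v := (speed x y).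
Notation k := (curvature x y).
Notation x' := (derive1 x).
Notation y' := (derive1 y).
Notation x'' := (derive1 (derive1 x)).
Notation y'' := (derive1 (derive1 y)).

Lemma C2_is_derive (f : R -> R) (t : R) : C2_on f D -> D t ->
  [/\ is_derive t 1 f (derive1 f t),
      is_derive t 1 (derive1 f) (derive1 (derive1 f) t),
      {for t, continuous f} & {for t, continuous (derive1 f)}].
Proof.
move=> C2 /C2[df ddf _]; split.
- by rewrite (derive1E f); exact: derivableP.
- by rewrite (derive1E (derive1 f)); exact: derivableP.
- by apply: differentiable_continuous; apply/derivable1_diffP.
- by apply: differentiable_continuous; apply/derivable1_diffP.
Qed.

Lemma speed_sqr_gt0 t : D t -> 0 < x' t ^+ 2 + y' t ^+ 2.
Proof.
move=> /imm; rewrite xpair_eqE negb_and => /orP[] h.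
- by rewrite ltr_pwDl ?sqr_ge0// exprn_even_gt0.
- by rewrite ltr_pwDr ?sqr_ge0// exprn_even_gt0.
Qed.

Lemma speed_gt0 t : D t -> 0 < v t.
Proof. by move=> Dt; rewrite sqrtr_gt0 speed_sqr_gt0. Qed.

Lemma sqr_speed t : v t ^+ 2 = x' t ^+ 2 + y' t ^+ 2.
Proof. by rewrite sqr_sqrtr// addr_ge0 ?sqr_ge0. Qed.

Lemma is_derive_speed t : D t ->
  is_derive t 1 v ((x' t * x'' t + y' t * y'' t) / v t).
Proof.
move=> Dt; have [_ dx _ _] := C2_is_derive x t C2x Dt.
have [_ dy _ _] := C2_is_derive y t C2y Dt.
have h : is_derive (((x' ^+ 2) + (y' ^+ 2)) t) 1 Num.sqrt _ :=
  is_derive1_sqrt (speed_sqr_gt0 t Dt).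
apply: (is_derive_eq
  (is_derive1_comp h (is_deriveD (is_deriveX 2 dx) (is_deriveX 2 dy)))).
rewrite /= !expr1 -![_ *: _]/(_ * _).
rewrite -[X in (2 * X)^-1]/(v t); have v0 := speed_gt0 t Dt.
move: (x'' t) (y'' t) (x' t) (y' t) (v t) v0 => d2x d2y dx1 dy1 w w0.
by field; rewrite gt_eqF.
Qed.

Definition tangentx t := x' t / v t.
Definition tangenty t := y' t / v t.

Lemma tangent_norm t : D t -> tangentx t ^+ 2 + tangenty t ^+ 2 = 1.
Proof.
move=> Dt; have v0 := speed_gt0 t Dt.
by rewrite !expr_div_n -mulrDl -sqr_speed divff// gt_eqF// exprn_gt0.
Qed.

(** The quotient rule shared by both tangent components; writing the squared speed as
    [x' ^+ 2 + y' ^+ 2] lets the numerator of the curvature factor out. *)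
Lemma is_derive_div_speed (f : R -> R) (df t : R) : D t -> is_derive t 1 f df ->
  is_derive t 1 (fun r => f r / v r)
    (((x' t ^+ 2 + y' t ^+ 2) * df - f t * (x' t * x'' t + y' t * y'' t)) / v t ^+ 3).
Proof.
move=> Dt dx; have dv := is_derive_speed t Dt; have v0 := speed_gt0 t Dt.
have vn0 : v t != 0 by rewrite gt_eqF.
apply: (is_derive_eq (is_deriveM dx (is_deriveV vn0 dv))).
rewrite -![_ *: _]/(_ * _) -sqr_speed.
move: (x' t * x'' t + y' t * y'' t) (f t) (v t) vn0 => z ft w w0; field.
exact: w0.
Qed.

(** First component of the Frenet equation: the derivative of the unit tangent is [k * v] times the
    normal [(- y', x') / v], and the speed cancels. *)
Lemma is_derive_tangentx t : D t -> is_derive t 1 tangentx (- k t * y' t).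
Proof.
move=> Dt; have [_ dx _ _] := C2_is_derive x t C2x Dt.
apply: (is_derive_eq (is_derive_div_speed _ _ t Dt dx)).
rewrite /curvature -(mulNr (_ - _)) mulrAC; congr (_ / _).
by move: (x'' t) (y'' t) (x' t) (y' t) => *; ring.
Qed.

Lemma is_derive_tangenty t : D t -> is_derive t 1 tangenty (k t * x' t).
Proof.
move=> Dt; have [_ dy _ _] := C2_is_derive y t C2y Dt.
apply: (is_derive_eq (is_derive_div_speed _ _ t Dt dy)).
rewrite /curvature mulrAC; congr (_ / _).
by move: (x'' t) (y'' t) (x' t) (y' t) => *; ring.
Qed.

Lemma speed_continuous t : D t -> {for t, continuous v}.
Proof.
move=> Dt; have dv := is_derive_speed t Dt.
by apply/differentiable_continuous/derivable1_diffP; exact: ex_derive.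
Qed.

Lemma curvature_density_continuous t : D t ->
  {for t, continuous (fun r => `|k r| * v r)}.
Proof.
move=> Dt; have [_ _ _ cx] := C2_is_derive x t C2x Dt.
have [_ _ _ cy] := C2_is_derive y t C2y Dt.
have [_ _ cx2] := C2x t Dt; have [_ _ cy2] := C2y t Dt.
have cv := speed_continuous t Dt; have v0 := speed_gt0 t Dt.
have cn : x' r * y'' r - y' r * x'' r @[r --> t] -->
    x' t * y'' t - y' t * x'' t.
  by exact: cvgB (cvgM cx cy2) (cvgM cy cx2).
have c3 : v r ^+ 3 @[r --> t] --> v t ^+ 3.
  exact: (continuous_comp cv (@exprn_continuous R 3 (v t))).
have v3 : v t ^+ 3 != 0 by rewrite gt_eqF// exprn_gt0.
have ck : k r @[r --> t] --> k t by exact: cvgM cn (cvgV v3 c3).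
exact: (@cvgM R R _ _ _ _ _ _ (cvg_norm ck) cv).
Qed.

Lemma gauss_density_continuous (x0 : R * R) (lam t : R) : D t ->
  {for t, continuous (fun r =>
    expR (- ((x r - x0.1) ^+ 2 + (y r - x0.2) ^+ 2) / (4 * lam)) * v r)}.
Proof.
move=> Dt; have [_ _ cx _] := C2_is_derive x t C2x Dt.
have [_ _ cy _] := C2_is_derive y t C2y Dt.
have cv := speed_continuous t Dt.
have csq (f : R -> R) c : {for t, continuous f} ->
    (f r - c) ^+ 2 @[r --> t] --> (f t - c) ^+ 2.
  move=> cf; have cfc : {for t, continuous (fun r => f r - c)}.
    exact: (cvgB cf (cvg_cst c)).
  exact: (continuous_comp cfc (@exprn_continuous R 2 (f t - c))).
have ce : {for t, continuous
    (fun r => - ((x r - x0.1) ^+ 2 + (y r - x0.2) ^+ 2) / (4 * lam))}.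
  exact: (cvgM (cvgN (cvgD (csq _ _ cx) (csq _ _ cy))) (cvg_cst (4 * lam)^-1)).
exact: (cvgM (continuous_comp ce (@continuous_expR R _)) cv).
Qed.

(* Projecting [T] on its displacement [(a, b)] reduces the claim to the monotonicity
   of the scalar function [f]. *)
Lemma tangent_displacement (K : R -> R) (s t : R) : s <= t ->
  `[s, t] `<=` D ->
  {in `[s, t], forall r : R, is_derive r 1 K (`|k r| * v r)} ->
  (tangentx t - tangentx s) ^+ 2 + (tangenty t - tangenty s) ^+ 2
    <= (K t - K s) ^+ 2.
Proof.
move=> st stD dK; set a := tangentx t - _; set b := tangenty t - _.
set w := Num.sqrt (a ^+ 2 + b ^+ 2).
have w2 : w ^+ 2 = a ^+ 2 + b ^+ 2 by rewrite sqr_sqrtr// addr_ge0 ?sqr_ge0.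
have w0 : 0 <= w by exact: sqrtr_ge0.
have Kst : K s <= K t.
  apply: (le_of_derive_ge0 _ _ _ _ st dK) => r _.
  by rewrite mulr_ge0 ?sqrtr_ge0.
pose f r := K r * w - (tangentx r * a + tangenty r * b).
pose df r := `|k r| * v r * w - ((- k r * y' r) * a + (k r * x' r) * b).
have fdf : {in `[s, t], forall r : R, is_derive r 1 f (df r)}.
  move=> r rst; have Dr : D r by exact: stD.
  have dx := is_derive_tangentx r Dr; have dy := is_derive_tangenty r Dr.
  apply: (is_derive_eq (is_deriveB (is_deriveM (dK r rst) (is_derive_cst w r 1))
    (is_deriveD (is_deriveM dx (is_derive_cst a r 1))
                (is_deriveM dy (is_derive_cst b r 1))))).
  by rewrite /cst /= !scaler0 !add0r -![_ *: _]/(_ * _) /df; ring.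
have df0 : {in `[s, t], forall r, 0 <= df r}.
  move=> r _; rewrite /df subr_ge0.
  rewrite (_ : _ + _ = k r * (x' r * b - y' r * a)); last first.
    by move: (x' r) (y' r) (k r) => *; ring.
  apply: le_trans (ler_norm _) _; rewrite normrM -mulrA ler_wpM2l//.
  (* Cauchy-Schwarz after squaring; by Lagrange's identity the defect is
     [(x' r * a + y' r * b) ^+ 2]. *)
  rewrite -ler_sqr ?nnegrE ?mulr_ge0 ?sqrtr_ge0//.
  rewrite real_normK ?num_real// exprMn w2 sqr_speed -subr_ge0.
  rewrite (_ : _ - _ = (x' r * a + y' r * b) ^+ 2) ?sqr_ge0//.
  by move: (x' r) (y' r) => *; ring.
have := le_of_derive_ge0 f df s t st fdf df0.
rewrite /f => fst.
(* The increment of the projection of the tangent on [(a, b)] is [a ^+ 2 + b ^+ 2], that is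
   [w ^+ 2]. *)
have wK : w ^+ 2 <= (K t - K s) * w.
  by rewrite w2 /a /b in fst *; lra.
rewrite -w2 ler_sqr ?nnegrE ?subr_ge0//.
have [->|wn0] := eqVneq w 0; first by rewrite subr_ge0.
by rewrite -(@ler_pM2r _ w) ?lt0r ?wn0.
Qed.

(** * Gaussian mass of one arc, then of a chain of arcs *)

Section arc.
Variables (x0 : R * R) (lam : R).
Hypothesis lam_gt0 : 0 < lam.

Notation gauss := (fun r =>
  expR (- ((x r - x0.1) ^+ 2 + (y r - x0.2) ^+ 2) / (4 * lam))).
Notation c := (Num.sqrt (4 * pi * lam))^-1.

(** Variance [2 * lam] turns the normal density into the weight of [Fgauss] restricted to a line. *)
Lemma normal_pdf_sqrt (m u : R) :
  normal_pdf m (Num.sqrt (2 * lam)) u = c * expR (- (u - m) ^+ 2 / (4 * lam)).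
Proof.
have s0 : Num.sqrt (2 * lam) != 0 by rewrite gt_eqF// sqrtr_gt0 mulr_gt0.
rewrite normal_pdfE// /normal_peak /normal_fun sqr_sqrtr ?mulr_ge0 ?ltW//.
rewrite (_ : 2 * lam * pi *+ 2 = 4 * pi * lam); last by ring.
by rewrite (_ : 2 * lam *+ 2 = 4 * lam); last by ring.
Qed.

(** With primitives [K] of the curvature density and [H] of the Gaussian density, integrals become
    increments, and the comparison with the line reduces to the sign of a derivative. *)
Lemma arc_gauss_le (K H : R -> R) (p q : R) : p <= q ->
  `[p, q] `<=` D ->
  {in `[p, q], forall r : R, is_derive r 1 K (`|k r| * v r)} ->
  {in `[p, q], forall r : R, is_derive r 1 H (gauss r * v r)} ->
  K q - K p <= pi / 2 ->
  c * (H q - H p) <= 2.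
Proof.
move=> pq pqD dK dH Kpi.
have Kle r s : r \in `[p, q] -> s \in `[p, q] -> r <= s -> K r <= K s.
  rewrite !in_itv/= => /andP[pr rq] /andP[ps sq] rs.
  apply: (le_of_derive_ge0 _ (fun r => `|k r| * v r) _ _ rs) => [z|z _].
    rewrite in_itv/= => /andP[rz zs]; apply: dK; rewrite in_itv/=.
    by rewrite (le_trans pr)// (le_trans zs).
  by rewrite mulr_ge0 ?sqrtr_ge0.
have pin : p \in `[p, q] by rewrite in_itv/= lexx.
have qin : q \in `[p, q] by rewrite in_itv/= lexx andbT.
have cK : {within `[p, q], continuous K}.
  by apply: derivable_within_continuous => r /dK ?; exact: ex_derive.
have Kpq := Kle p q pin qin pq.
(* The curvature midpoint: at most [pi / 4] of curvature lies on either side of [m]. *)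
have [m mpq Km] : exists2 m, m \in `[p, q] & K m = (K p + K q) / 2.
  apply: IVT => //; rewrite (min_idPl Kpq) (max_idPr Kpq); apply/andP; split; lra.
set a := tangentx m; set b := tangenty m.
have ab1 : a ^+ 2 + b ^+ 2 = 1 by apply: tangent_norm; exact: pqD.
have pi4 : pi < 4 :> R by have := @pihalf_lt2 R; lra.
have Te r : r \in `[p, q] -> 1 / 2 <= a * tangentx r + b * tangenty r.
  move=> rpq; have Tr1 := tangent_norm r (pqD _ rpq).
  have : (tangentx r - a) ^+ 2 + (tangenty r - b) ^+ 2 <= (K r - K m) ^+ 2.
    have sub s t : s \in `[p, q] -> t \in `[p, q] -> {subset `[s, t] <= `[p, q]}.
      rewrite !in_itv/= => /andP[ps sq] /andP[pt tq] z; rewrite !in_itv/=.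
      by move=> /andP[sz zt]; rewrite (le_trans ps)// (le_trans zt).
    (* [tangent_displacement] wants ordered parameters; to the left of [m] the differences change
       sign under the squares. *)
    have [rm|mr] := leP r m.
      rewrite -(sqrrN (K r - _)) -(sqrrN (tangentx r - _)) -(sqrrN (tangenty r - _)).
      rewrite !opprB; apply: tangent_displacement => // [z /(sub _ _ rpq mpq)|].
        exact: pqD.
      by move=> z /(sub _ _ rpq mpq); exact: dK.
    apply: tangent_displacement (ltW mr) _ _ => [z /(sub _ _ mpq rpq)|].
      exact: pqD.
    by move=> z /(sub _ _ mpq rpq); exact: dK.
  have : (K r - K m) ^+ 2 <= 1.
    have := Kle p r pin rpq; have := Kle r q rpq qin.
    rewrite in_itv/= in rpq; case/andP: rpq => -> -> /(_ isT) ? /(_ isT) ?.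
    have d1 : K r - K m <= 1 by lra.
    have d2 : - 1 <= K r - K m by lra.
    by rewrite -(real_normK (num_real (K r - K m))) exprn_ile1// ler_norml d1 d2.
  (* For unit vectors the squared distance is 2 minus twice the inner product, so a distance of at
     most 1 gives an inner product of at least [1 / 2]. *)
  move: Tr1 ab1; lra.
pose u r := a * x r + b * y r.
have du r : r \in `[p, q] -> is_derive r 1 u (a * x' r + b * y' r).
  move=> /pqD Dr; have [dx _ _ _] := C2_is_derive x r C2x Dr.
  have [dy _ _ _] := C2_is_derive y r C2y Dr.
  apply: (is_derive_eq (is_deriveD (is_deriveM (is_derive_cst a r 1) dx)
    (is_deriveM (is_derive_cst b r 1) dy))).
  by rewrite /cst /= !scaler0 !addr0.
have u'v r : r \in `[p, q] -> v r <= 2 * (a * x' r + b * y' r).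
  move=> rpq; have v0 := speed_gt0 r (pqD _ rpq); have := Te r rpq.
  rewrite /tangentx /tangenty !mulrA -mulrDl ler_pdivlMr//; lra.
have u'0 r : r \in `[p, q] -> 0 <= a * x' r + b * y' r.
  by move=> rpq; have := u'v r rpq; have := speed_gt0 r (pqD _ rpq); lra.
(* Monotonicity keeps [u r] between [u p] and [u q], where [Phi] is known to be differentiable. *)
have ule r s : p <= r -> r <= s -> s <= q -> u r <= u s.
  move=> pr rs sq; apply: (le_of_derive_ge0 _ (fun r => a * x' r + b * y' r) _ _ rs).
    move=> z; rewrite in_itv/= => /andP[rz zs]; apply: du.
    by rewrite in_itv/= (le_trans pr)// (le_trans zs).
  move=> z; rewrite in_itv/= => /andP[rz zs]; apply: u'0.
  by rewrite in_itv/= (le_trans pr)// (le_trans zs).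
pose m0 := a * x0.1 + b * x0.2.
have s0 : Num.sqrt (2 * lam) != 0 by rewrite gt_eqF// sqrtr_gt0 mulr_gt0.
have [Phi dPhi Phi1] := normal_primitive m0 _ (u p) (u q) s0.
have c0 : 0 < c by rewrite invr_gt0 sqrtr_gt0 !mulr_gt0// pi_gt0.
(* Once [f] is nondecreasing, [c * (H q - H p)] is at most twice an increment of [Phi], hence at
   most 2. *)
pose f r := 2 * Phi (u r) - c * H r.
pose df r := 2 * (c * expR (- (u r - m0) ^+ 2 / (4 * lam)) * (a * x' r + b * y' r))
  - c * (gauss r * v r).
have fdf : {in `[p, q], forall r : R, is_derive r 1 f (df r)}.
  move=> r rpq; have := rpq; rewrite in_itv/= => /andP[pr rq].
  have dP : is_derive (u r) 1 Phi (normal_pdf m0 (Num.sqrt (2 * lam)) (u r)).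
    by apply: dPhi; rewrite in_itv/= !ule.
  have d1 := is_deriveM (is_derive_cst (2 : R) r 1) (is_derive1_comp dP (du r rpq)).
  have d2 := is_deriveM (is_derive_cst c r 1) (dH r rpq).
  apply: (is_derive_eq (is_deriveB d1 d2)).
  by rewrite /cst /= !scaler0 !addr0 normal_pdf_sqrt.
have df0 : {in `[p, q], forall r, 0 <= df r}.
  move=> r rpq; rewrite /df subr_ge0 -(mulrA c) (mulrCA 2).
  apply: (ler_wpM2l (ltW c0)); rewrite (mulrCA 2).
  (* The factors are compared separately: the exponential grows under projection, and the speed is
     at most twice the derivative of [u]. *)
  apply: ler_pM; [exact: expR_ge0|exact: sqrtr_ge0| |exact: u'v].
  have l0 : 0 <= (4 * lam)^-1 by rewrite invr_ge0 mulr_ge0// ltW.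
  rewrite ler_expR !mulNr lerN2; apply: ler_wpM2r l0 _ _ _.
  rewrite -[leRHS]mul1r -ab1 -subr_ge0.
  (* Pythagoras: what the projection loses is the squared component orthogonal to [(a, b)]. *)
  rewrite (_ : _ - _ = (a * (y r - x0.2) - b * (x r - x0.1)) ^+ 2) ?sqr_ge0//.
  by rewrite /u /m0; ring.
have := le_of_derive_ge0 f df p q pq fdf df0; rewrite /f.
have := Phi1 (ule _ _ (lexx p) pq (lexx q)); lra.
Qed.

(** Induction on the number [n.+1] of arcs: an initial arc using exactly [pi / 2] of curvature is
    cut off, and the rest falls under the induction hypothesis. *)
Lemma curve_gauss_le (K H : R -> R) (n : nat) (p q : R) : p <= q ->
  `[p, q] `<=` D ->
  {in `[p, q], forall r : R, is_derive r 1 K (`|k r| * v r)} ->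
  {in `[p, q], forall r : R, is_derive r 1 H (gauss r * v r)} ->
  K q - K p <= n.+1%:R * (pi / 2) ->
  c * (H q - H p) <= 2 * n.+1%:R.
Proof.
elim: n p => [|n IHn] p pq pqD dK dH Kpi.
  by rewrite mulr1; apply: (arc_gauss_le K) => //; rewrite mul1r in Kpi.
have pi2 : 0 < pi / 2 :> R by rewrite divr_gt0 ?pi_gt0.
have n2 : n.+2%:R = n.+1%:R + 1 :> R by rewrite natr1.
rewrite n2 in Kpi *.
(* With so little curvature the whole curve is one arc; otherwise the intermediate value theorem for
   [K] supplies the cut. *)
have [Kle|Kgt] := leP (K q - K p) (pi / 2).
  have := arc_gauss_le K H p q pq pqD dK dH Kle.
  have : (0 : R) <= n.+1%:R by [].
  lra.
have cK : {within `[p, q], continuous K}.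
  by apply: derivable_within_continuous => r /dK ?; exact: ex_derive.
have [m mpq Km] : exists2 m, m \in `[p, q] & K m = K p + pi / 2.
  have Kpq : K p <= K q by lra.
  apply: IVT => //; rewrite (min_idPl Kpq) (max_idPr Kpq); apply/andP; split; lra.
have := mpq; rewrite in_itv/= => /andP[pm mq].
have subl : {subset `[p, m] <= `[p, q]}.
  by move=> z; rewrite !in_itv/= => /andP[-> /le_trans->].
have subr : {subset `[m, q] <= `[p, q]}.
  by move=> z; rewrite !in_itv/= => /andP[/(le_trans pm)-> ->].
have h1 : c * (H m - H p) <= 2.
  apply: (arc_gauss_le K) => //.
  - by move=> z /subl; exact: pqD.
  - by move=> z /subl; exact: dK.
  - by move=> z /subl; exact: dH.
  - by lra.
have h2 : c * (H q - H m) <= 2 * n.+1%:R.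
  apply: IHn => //.
  - by move=> z /subr; exact: pqD.
  - by move=> z /subr; exact: dK.
  - by move=> z /subr; exact: dH.
  - by lra.
lra.
Qed.

End arc.
End tangent.

(** * Exhausting a possibly unbounded parameter interval *)

Lemma ereal_left_exhaustion {R : realType} (a : \bar R) : a != +oo%E ->
  exists p : R^nat, [/\ nonincreasing_seq p, forall n, (a < (p n)%:E)%E &
    forall t : R, (a < t%:E)%E -> exists n, p n < t].
Proof.
case: a => [a _|//|_].
- exists (fun n => a + n.+1%:R^-1); split.
  + by move=> m n mn; rewrite lerD2l lef_pV2 ?posrE// ler_nat ltnS.
  + by move=> n; rewrite lte_fin ltrDl invr_gt0.
  + by move=> t; rewrite lte_fin => /ltr_add_invr.
- exists (fun n => - n%:R); split.
  + by move=> m n mn; rewrite lerN2 ler_nat.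
  + by move=> n; exact: ltNyr.
  + move=> t _; exists (Num.bound `|t|); rewrite ltrNl.
    apply: le_lt_trans (archi_boundP (normr_ge0 t)).
    by rewrite -normrN ler_norm.
Qed.

Lemma ereal_right_exhaustion {R : realType} (b : \bar R) : b != -oo%E ->
  exists q : R^nat, [/\ nondecreasing_seq q, forall n, ((q n)%:E < b)%E &
    forall t : R, (t%:E < b)%E -> exists n, t < q n].
Proof.
move=> bNy; have [|p [pd pb pt]] := @ereal_left_exhaustion R (- b)%E.
  by case: b bNy.
exists (fun n => - p n); split.
- by move=> m n mn; rewrite lerN2; exact: pd.
- by move=> n; rewrite EFinN lteNl; exact: pb.
- move=> t tb; have [|n pn] := pt (- t); first by rewrite EFinN lteN2.
  by exists n; rewrite ltrNr.
Qed.

Lemma open_param_int {R : realType} (a b : \bar R) : open (param_int a b).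
Proof.
have -> : param_int a b = [set t | (a < t%:E)%E] `&` [set t | (t%:E < b)%E].
  by apply/seteqP; split => t /=; [case/andP | move=> ?; apply/andP].
by apply: openI; [exact: open_ereal_gt|exact: open_ereal_lt].
Qed.

Lemma param_int_convex {R : realType} (a b : \bar R) (p q : R) :
  (a < p%:E)%E -> (q%:E < b)%E -> `[p, q] `<=` param_int a b.
Proof.
move=> ap qb t /=; rewrite in_itv/= => /andP[pt tq]; rewrite /param_int /=.
by rewrite (lt_le_trans ap) ?lee_fin//= (le_lt_trans _ qb) ?lee_fin.
Qed.

(** * The entropy bound *)

Theorem theorem3p3 (R : realType) (x y : R -> R) (a b : \bar R) (alpha : nat) :
  (a < b)%E ->
  C2_on x (param_int a b) -> C2_on y (param_int a b) ->
  immersed_on x y (param_int a b) ->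
  (0 < alpha)%N ->
  (total_curvature x y a b <= (alpha%:R * pi)%:E)%E ->
  (Ent x y a b <= (4 * alpha%:R * Num.sqrt 2)%:E)%E.
Proof.
move=> ab C2x C2y imm alpha0 tc.
have aNy : a != +oo%E by apply: contraTneq ab => ->; rewrite -leNgt leey.
have bNy : b != -oo%E by apply: contraTneq ab => ->; rewrite -leNgt leNye.
have [p [pd pa pt]] := ereal_left_exhaustion a aNy.
have [q [qi qb qt]] := ereal_right_exhaustion b bNy.
set D := param_int a b in C2x C2y imm.
have oD : open D by exact: open_param_int.
apply: ub_ereal_sup => _ [x0 [lam [lam0 ->]]]; rewrite /Fgauss -/D.
set c := (Num.sqrt _)^-1.
pose g t := expR (- ((x t - x0.1) ^+ 2 + (y t - x0.2) ^+ 2) / (4 * lam))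
  * speed x y t.
have c0 : 0 < c by rewrite invr_gt0 sqrtr_gt0 !mulr_gt0// pi_gt0.
have cg : {in D, continuous g}.
  by move=> t; rewrite inE => Dt; exact: gauss_density_continuous Dt.
pose f t := `|curvature x y t| * speed x y t.
have cf : {in D, continuous f}.
  by move=> t; rewrite inE => Dt; exact: curvature_density_continuous Dt.
have f0 t : 0 <= f t by rewrite mulr_ge0 ?sqrtr_ge0.
have g0 t : 0 <= g t by rewrite mulr_ge0 ?sqrtr_ge0 ?expR_ge0.
have sqrt2 : 1 <= Num.sqrt 2 :> R by rewrite -[leLHS]sqrtr1 ler_sqrt// ler1n.
(* As [Num.sqrt 2] is at least 1, a Gaussian mass of at most [4 * alpha] suffices. *)
suff main : (\int[lebesgue_measure]_(t in D) (g t)%:E <= (c^-1 * (4 * alpha%:R))%:E)%E.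
  apply: le_trans (lee_wpmul2l _ main) _.
    by rewrite lee_fin ltW.
  rewrite -EFinM mulVKf ?gt_eqF// lee_fin.
  by rewrite ler_peMr// mulr_ge0.
apply: (@integral_exhaust_le R D p q) => //.
- by move=> n; exact: param_int_convex.
- move=> t /andP[/pt[m pm] /qt[n qn]]; exists (maxn m n); apply/andP; split.
    by rewrite (le_trans _ (ltW pm))//; apply: pd; rewrite leq_maxl.
  by rewrite (le_trans (ltW qn))//; apply: qi; rewrite leq_maxr.
(* The two endpoint sequences are chosen independently and may cross for small [n]. *)
move=> n; have [qp|pq] := ltP (q n) (p n).
  rewrite set_itv_ge ?bnd_simp -?ltNge// integral_set0 lee_fin.
  by rewrite !mulr_ge0// invr_ge0 ltW.
have pqD := @param_int_convex R a b (p n) (q n) (pa n) (qb n).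
(* A strictly larger compact interval inside [D], so that the primitives are differentiable at [p n]
   and [q n] too. *)
have [m1 pm] := pt _ (pa n); have [m2 qm] := qt _ (qb n).
have wD := @param_int_convex R a b (p m1) (q m2) (pa m1) (qb m2).
have inD t : t \in `[p m1, q m2] -> t \in D by move=> /wD; rewrite inE.
have [K dK] := @primitive_exists R f (p m1) (q m2) (fun t h => cf t (inD t h)).
have [H dH] := @primitive_exists R g (p m1) (q m2) (fun t h => cg t (inD t h)).
have sub t : t \in `[p n, q n] -> t \in `]p m1, q m2[.
  rewrite !in_itv/= => /andP[pnt tqn].
  by rewrite (lt_le_trans pm)// (le_lt_trans tqn).
have dK' : {in `[p n, q n], forall t : R, is_derive t 1 K (f t)}.
  by move=> t /sub; exact: dK.
have dH' : {in `[p n, q n], forall t : R, is_derive t 1 H (g t)}.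
  by move=> t /sub; exact: dH.
have inD' t : t \in `[p n, q n] -> t \in D by move=> /pqD; rewrite inE.
have cf' : {in `[p n, q n], continuous f} by move=> t /inD'; exact: cf.
have cg' : {in `[p n, q n], continuous g} by move=> t /inD'; exact: cg.
rewrite (integral_primitive _ _ _ _ pq cg' dH') lee_fin ler_pdivlMl//.
have Kpi : K (q n) - K (p n) <= alpha%:R * pi.
  rewrite -lee_fin -(integral_primitive _ _ _ _ pq cf' dK').
  apply: le_trans tc; apply: ge0_subset_integral => //.
  - exact: open_measurable.
  - by apply/measurable_EFinP; exact: open_continuous_measurable_fun.
  - by move=> t _; rewrite lee_fin f0.
(* There are [2 * alpha] arcs, written as a successor to match [curve_gauss_le]; this uses that
   [alpha] is positive. *)
have -> : 4 * alpha%:R = 2 * (2 * alpha).-1.+1%:R :> R.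
  by rewrite prednK ?muln_gt0// natrM; ring.
apply: (@curve_gauss_le R x y D C2x C2y imm x0 lam lam0 K H) => //.
rewrite prednK ?muln_gt0// natrM; lra.
Qed.
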